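(* Let $A\in\mathbb{C}^{2n\times2n}$ be skew-coninvolutory, i.e. $A\overline{A}=-I_{2n}$. Then there exist real numbers $\sigma_1\ge\cdots\ge\sigma_n\ge1$ and vectors $u_1,\dots,u_n,v_1,\dots,v_n\in\mathbb{C}^{2n}$ such that the $2n$ singular values of $A$ (with multiplicity) are given by the pairs $(\sigma_j,\frac{1}{\sigma_j})$, $j=1,\dots,n$, associated with the singular triplets $(u_j,v_j,\sigma_j)$ and $(-\overline{v}_j,\overline{u}_j,\frac1{\sigma_j})$, $j=1,\dots,n$, and $A=U\Sigma V^H$ is a singular value decomposition of $A$ (with $U,V$ unitary), where $$\Sigma=\begin{bmatrix}S&0\\0&S^{-1}\end{bmatrix},\quad S=\operatorname{diag}(\sigma_1,\dots,\sigma_n),$$ $$U=[u_1,\dots,u_n,\,-\overline{v}_1,\dots,-\overline{v}_n],\qquad V=[v_1,\dots,v_n,\,\overline{u}_1,\dots,\overline{u}_n].$$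
   Context: $\overline{X}$ is the entrywise complex conjugate and $X^H$ the conjugate transpose. A singular value decomposition of $A\in\mathbb{C}^{2n\times 2n}$ is $A=U\Sigma V^H$ with $U,V$ unitary and $\Sigma$ diagonal with nonnegative real diagonal entries, the singular values; here the diagonal of $\Sigma$ need not be sorted by magnitude. A singular triplet of $A$ is $(u,v,\sigma)$ with $u$ a left and $v$ a right singular vector of $A$ for the singular value $\sigma$: $u,v$ are unit vectors with $Av=\sigma u$ and $A^Hu=\sigma v$. *)

(* Defs.v *)
From mathcomp Require Import all_boot all_order all_algebra.
From mathcomp Require Import complex.
From mathcomp Require Import reals.

Set Implicit Arguments.
Unset Strict Implicit.
Unset Printing Implicit Defensive.

Import Order.TTheory GRing.Theory Num.Theory.
Local Open Scope ring_scope.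
Local Open Scope complex_scope.
Local Open Scope sesquilinear_scope.

Definition conj_mx (R : realType) (m n : nat) (X : 'M[R[i]]_(m, n)) :
    'M[R[i]]_(m, n) :=
  map_mx Num.conj X.

Definition skew_coninvolutory (R : realType) (m : nat) (A : 'M[R[i]]_m) : Prop :=
  A *m conj_mx A = - 1%:M.

(* In the partial order of R[i], 0 <= z means that z is real and nonnegative.
   The diagonal of Sigma is not required to be sorted. *)
Definition is_svd (R : realType) (m : nat) (A U Sigma V : 'M[R[i]]_m) : Prop :=
  [/\ U \is unitarymx, V \is unitarymx, is_diag_mx Sigma,
      forall i, 0 <= Sigma i i & A = U *m Sigma *m V^t*].

(* s lists the singular values of A with multiplicity, in some order.
   Quantifying over all decompositions makes this independent of the choice
   of one. *)
Definition singular_values (R : realType) (m : nat) (A : 'M[R[i]]_m)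
    (s : seq R) : Prop :=
  (exists U Sigma V, is_svd A U Sigma V) /\
  (forall U Sigma V, is_svd A U Sigma V ->
     perm_eq [seq Sigma i i | i : 'I_m] [seq x%:C | x <- s]).

Definition unit_vector (R : realType) (m : nat) (u : 'cV[R[i]]_m) : Prop :=
  \sum_i `|u i ord0| ^+ 2 = 1.

Definition singular_triplet (R : realType) (m : nat) (A : 'M[R[i]]_m)
    (u v : 'cV[R[i]]_m) (sigma : R) : Prop :=
  [/\ 0 <= sigma, unit_vector u, unit_vector v,
      A *m v = sigma%:C *: u & A^t* *m u = sigma%:C *: v].

Definition mx_of_cols (R : realType) (m n : nat) (u : 'I_n -> 'cV[R[i]]_m) :
    'M[R[i]]_(m, n) :=
  \matrix_(i, j) u j i ord0.

(* Main.v *)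
Require Import Defs.
From mathcomp Require Import all_boot all_order all_algebra.
From mathcomp Require Import complex reals perm.

Set Implicit Arguments.
Unset Strict Implicit.
Unset Printing Implicit Defensive.

Import Order.TTheory GRing.Theory Num.Theory.
Local Open Scope ring_scope.
Local Open Scope sesquilinear_scope.

(** The singular triplets come in pairs because of the antilinear map
    v |-> conj (A v).  If A v = s conj w and A^H conj w = s v, so that
    (conj w, v, s) is a singular triplet, then multiplying the conjugates of
    these equations by A and A^H, and using A conj A = -1, gives
    A w = s^-1 conj (- v) and A^H conj (- v) = s^-1 w.  Hence (w, - v, s^-1)
    satisfies the same equations ([paired_swap]), and its triplet is
    (- conj v, conj u, s^-1) with u = conj w.

    It remains to choose the v_j so that the v_j together with their partners
    w_j are orthonormal.  This is done greedily ([exists_paired_frame]).  The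
    span of the pairs found so far is stable under A^H A, hence so is its
    orthogonal complement, which thus contains a unit eigenvector v of A^H A as
    long as fewer than n pairs have been found.  Its partner
    w = conj (A v) / s is orthogonal to v, whatever s is, even for s = 1,
    because v^T A v equals both s w^H v and - s^-1 w^H v
    ([paired_isotropic]), and it is orthogonal to the earlier pairs because the
    triplet equations move orthogonality to v over to w ([paired_ortho]).  If
    s < 1, the pair (v, w) is replaced by (w, - v), whose singular value is
    s^-1 > 1.

    After n steps V = [v, w] is unitary, hence so is U = [conj w, - conj v],
    and A V = U Sigma.  A permutation of the pairs sorts the singular values.
    That these are all the singular values of A, whichever decomposition is
    used, follows since the squares of the diagonal entries of Sigma are the
    roots, with multiplicity, of the characteristic polynomial of A^H A
    ([svd_diag_unique]). *)

(** * Entrywise conjugates, adjoints and eigenvectors *)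

Local Notation cj := (map_mx Num.conj).

Section ConjugateMatrices.

Variable C : numClosedFieldType.

Lemma map_conjK m n (X : 'M[C]_(m, n)) : cj (cj X) = X.
Proof. by apply/matrixP => i j; rewrite !mxE conjCK. Qed.

Lemma trmxC_mul m n p (X : 'M[C]_(m, n)) (Y : 'M[C]_(n, p)) :
  (X *m Y)^t* = Y^t* *m X^t*.
Proof. by rewrite trmx_mul map_mxM. Qed.

Lemma trmxC_conj m n (X : 'M[C]_(m, n)) : (cj X)^t* = X^T.
Proof. by rewrite map_trmx map_conjK. Qed.

Lemma conj_trmxC m n (X : 'M[C]_(m, n)) : cj (X^t*) = X^T.
Proof. exact: map_conjK. Qed.

Lemma trmxC_row_mx m n1 n2 (X : 'M[C]_(m, n1)) (Y : 'M[C]_(m, n2)) :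
  (row_mx X Y)^t* = col_mx (X^t*) (Y^t*).
Proof. by rewrite tr_row_mx map_col_mx. Qed.

Lemma conj_mxN m n (X : 'M[C]_(m, n)) : cj (- X) = - cj X.
Proof. exact: map_mxN. Qed.

Lemma conj_mxZ m n (X : 'M[C]_(m, n)) a : cj (a *: X) = Num.conj a *: cj X.
Proof. by rewrite map_mxZ. Qed.

Lemma trmxCN m n (X : 'M[C]_(m, n)) : (- X)^t* = - X^t*.
Proof. by rewrite linearN conj_mxN. Qed.

Lemma trmxCZ m n (X : 'M[C]_(m, n)) a : (a *: X)^t* = Num.conj a *: X^t*.
Proof. by rewrite linearZ conj_mxZ. Qed.

Lemma trmxC_diag_ge0 n (d : 'rV[C]_n) :
  (forall j, 0 <= d 0 j) -> (diag_mx d)^t* = diag_mx d.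
Proof.
move=> d_ge0; rewrite tr_diag_mx map_diag_mx; congr diag_mx.
by apply/rowP => j; rewrite mxE; exact: geC0_conj.
Qed.

Lemma conj_diag_ge0 n (d : 'rV[C]_n) :
  (forall j, 0 <= d 0 j) -> cj (diag_mx d) = diag_mx d.
Proof.
by move=> d_ge0; rewrite -{2}(trmxC_diag_ge0 d_ge0) tr_diag_mx.
Qed.

Lemma trmxC_mul_eq0C m n p (X : 'M[C]_(m, n)) (Y : 'M[C]_(m, p)) :
  X^t* *m Y = 0 -> Y^t* *m X = 0.
Proof.
by move=> XY0; rewrite -[X]trmxCK -trmxC_mul XY0 trmx0 map_mx0.
Qed.

(** In the basis [row_base B], [H] acts on the row space of [B] as the square
    matrix [restrictmx B H], and that matrix has an eigenvalue. *)
Lemma stable_row_eigenvector m n (B : 'M[C]_(m, n)) (H : 'M[C]_n) :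
  stablemx B H -> B != 0 ->
  exists2 x : 'rV_n, x != 0 & (x <= B)%MS /\ exists a, x *m H = a *: x.
Proof.
move=> BH B_neq0.
have [a /eigenvalueP[y yBH y_neq0]] : exists a, eigenvalue (restrictmx B H) a.
  by apply: eigenvalue_closed; rewrite lt0n mxrank_eq0.
exists (y *m row_base B); first by rewrite mulmx_free_eq0 ?row_base_free.
split; first by rewrite mulmx_sub // eq_row_base.
have /submxP[X BHX] : (row_base B *m H <= row_base B)%MS.
  by rewrite (eqmxMr _ (eq_row_base B)) eq_row_base.
have XE : X = restrictmx B H.
  by rewrite /conjmx BHX mulmxKp // row_base_free.
by exists a; rewrite -mulmxA BHX XE mulmxA yBH -scalemxAl.
Qed.

Lemma sum_norm_gram n (v : 'cV[C]_n) :
  \sum_i `|v i ord0| ^+ 2 = (v^t* *m v) 0 0.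
Proof.
by rewrite mxE; apply: eq_bigr => i _; rewrite !mxE mulrC normCK.
Qed.

Lemma gram_gt0 n (v : 'cV[C]_n) : v != 0 -> 0 < (v^t* *m v) 0 0.
Proof.
move=> v_neq0; rewrite -sum_norm_gram lt_def sumr_ge0 ?andbT; last first.
  by move=> i _; rewrite exprn_ge0.
apply: contraNneq v_neq0 => /eqP; rewrite psumr_eq0 => [/allP v0|i _].
  apply/eqP/colP => i; have := v0 i (mem_index_enum i).
  by rewrite /= sqrf_eq0 normr_eq0 mxE => /eqP.
exact: exprn_ge0.
Qed.

Lemma diag_mxV k (d : 'rV[C]_k) : (forall j, 0 < d 0 j) ->
  diag_mx d *m diag_mx (map_mx GRing.inv d) = 1%:M.
Proof.
move=> d_gt0; rewrite mulmx_diag -diag_const_mx; congr diag_mx.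
by apply/rowP => j; rewrite !mxE divff // gt_eqF.
Qed.

Lemma mulmx_diagK n k (X : 'M[C]_(n, k)) (d : 'rV[C]_k) :
  (forall j, 0 < d 0 j) -> X *m diag_mx d *m diag_mx (map_mx GRing.inv d) = X.
Proof. by move=> d_gt0; rewrite -mulmxA diag_mxV ?mulmx1. Qed.

End ConjugateMatrices.

(** * Paired singular vectors of a skew-coninvolutory matrix *)

Section Paired.

Variables (C : numClosedFieldType) (m : nat) (A : 'M[C]_m).

(** The columns of [conj W], those of [V] and the entries of [d] are singular
    triplets of [A].  Recording the conjugates [W] of the left vectors makes
    the symmetry [paired_swap] visible, and puts [V] and [W] together as the
    right singular vectors. *)
Definition paired k (V W : 'M[C]_(m, k)) (d : 'rV[C]_k) :=
  [/\ forall j, 0 < d 0 j, A *m V = cj W *m diag_mx d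
    & A^t* *m cj W = V *m diag_mx d].

Hypothesis skewA : A *m cj A = - 1%:M.

(** Conjugating [A V = conj W D] and multiplying by [A] gives
    [- conj V = A W D], since [A (conj A) = - 1]; the second equation is
    treated alike, with [A^H A^T = (A (conj A))^T = - 1]. *)
Lemma paired_swap k (V W : 'M[C]_(m, k)) d :
  paired V W d -> paired W (- V) (map_mx GRing.inv d).
Proof.
case=> d_gt0 AV AW; have d_ge0 j : 0 <= d 0 j by rewrite ltW.
split=> [j||]; first by rewrite mxE invr_gt0.
  have : A *m W *m diag_mx d = - cj V.
    have /(congr1 (fun X => A *m cj X)) := AV.
    rewrite !map_mxM map_conjK conj_diag_ge0 // !mulmxA skewA mulNmx mul1mx.
    by move=> <-.
  move=> /(congr1 (mulmx^~ (diag_mx (map_mx GRing.inv d)))).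
  by rewrite mulmx_diagK // map_mxN.
have : A^t* *m cj V *m diag_mx d = - W.
  have /(congr1 (fun X => A^t* *m cj X)) := AW.
  rewrite !map_mxM conj_diag_ge0 // conj_trmxC map_conjK !mulmxA => <-.
  have -> : A^t* *m A^T = - 1%:M.
    by rewrite -map_trmx -trmx_mul skewA linearN /= trmx1.
  by rewrite mulNmx mul1mx.
move=> /(congr1 (mulmx^~ (diag_mx (map_mx GRing.inv d)))).
by rewrite mulmx_diagK // map_mxN mulmxN => ->; rewrite mulNmx opprK.
Qed.

(** [W^T (conj w) E = W^T A v = (A^H conj W)^H v = D V^H v], and [E] is
    invertible.  With [paired_swap] the same lemma turns [W^H v = 0] into
    [V^H w = 0]. *)
Lemma paired_ortho k l (V W : 'M[C]_(m, k)) d (v w : 'M[C]_(m, l)) e :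
  paired V W d -> paired v w e -> V^t* *m v = 0 -> W^t* *m w = 0.
Proof.
case=> d_gt0 _ AW [e_gt0 Av _] Vv0.
have : W^T *m cj w *m diag_mx e = 0.
  rewrite -mulmxA -Av mulmxA -trmxC_conj -[A]trmxCK -trmxC_mul AW.
  by rewrite trmxC_mul -mulmxA Vv0 mulmx0.
move=> /(congr1 (fun X => cj (X *m diag_mx (map_mx GRing.inv e)))).
by rewrite mulmx_diagK // mul0mx map_mxM map_conjK map_mx0.
Qed.

(** Computing the number [v^T A v] from the two triplets of the pair shows that
    [z = w^H v] satisfies [s z = - s^-1 z]; since [s + s^-1 > 0], it vanishes.
    This includes the singular value [1], for which [v] and [w] lie in the same
    eigenspace of [A^H A]. *)
Lemma paired_isotropic (v w : 'cV[C]_m) e : paired v w e -> w^t* *m v = 0.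
Proof.
move=> vw; have [e_gt0 Av _] := vw; have [_ _] := paired_swap vw.
rewrite conj_mxN mulmxN => /(canRL (@opprK _)) Acv.
set z := w^t* *m v; set s := e 0 0.
have s_gt0 : 0 < s by apply: e_gt0.
have e_const : e = const_mx s by apply/rowP => j; rewrite ord1 mxE.
have eE : diag_mx e = s%:M by rewrite e_const diag_const_mx.
have eVE : diag_mx (map_mx GRing.inv e) = s^-1%:M.
  by rewrite e_const map_const_mx diag_const_mx.
have : s *: z = - (s^-1 *: z).
  transitivity (v^T *m A *m v).
    rewrite -mulmxA Av mulmxA eE mul_mx_scalar; congr (_ *: _).
    (* a 1 x 1 matrix is its own transpose *)
    rewrite [RHS]mx11_scalar -tr_scalar_mx -mx11_scalar.
    by rewrite trmx_mul map_trmx trmxK.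
  rewrite -[A]trmxCK -trmxC_conj -trmxC_mul Acv.
  rewrite eVE mul_mx_scalar trmxCN mulNmx trmxCZ.
  by rewrite -scalemxAl geC0_conj // invr_ge0 ltW.
move=> /eqP; rewrite -addr_eq0 -scalerDl scaler_eq0 => /orP[|/eqP//].
by rewrite gt_eqF // addr_gt0 ?invr_gt0.
Qed.

(** The partner of [v] is [conj (A v) / s] with [s = sqrt b].  Here [b] is a
    positive number because it is the squared norm of [A v], and [A] is
    invertible. *)
Lemma eigenvector_paired (v : 'cV[C]_m) b :
  v^t* *m v = 1%:M -> A^t* *m A *m v = b *: v ->
  exists w e, paired v w e /\ w^t* *m w = 1%:M.
Proof.
move=> v1 Hv.
have A_unit : A \in unitmx.
  by have /mulmx1_unit[] : A *m (- cj A) = 1%:M by rewrite mulmxN skewA opprK.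
have Av_neq0 : A *m v != 0.
  apply: contra_eq_neq v1 => Av0; have -> : v = 0.
    by rewrite -[v](mulKmx A_unit) Av0 mulmx0.
  rewrite mulmx0; apply/negP => /eqP/matrixP/(_ 0 0)/eqP.
  by rewrite !mxE eq_sym oner_eq0.
have AvAv : (A *m v)^t* *m (A *m v) = b%:M.
  by rewrite trmxC_mul -mulmxA (mulmxA (A^t*)) Hv -scalemxAr v1 scalemx1.
have b_gt0 : 0 < b.
  by have := gram_gt0 Av_neq0; rewrite AvAv mxE mulr1n.
pose s := sqrtC b; have s_gt0 : 0 < s by rewrite sqrtC_gt0.
have ss : s * s = b by rewrite -expr2 sqrtCK.
have sJ : Num.conj s = s by rewrite geC0_conj ?ltW.
have sVJ : Num.conj s^-1 = s^-1 by rewrite geC0_conj ?invr_ge0 ?ltW.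
have wE : cj (s^-1 *: cj (A *m v)) = s^-1 *: (A *m v).
  by rewrite conj_mxZ map_conjK sVJ.
exists (s^-1 *: cj (A *m v)), (const_mx s); split.
  split=> [j||]; first by rewrite mxE.
    by rewrite wE diag_const_mx mul_mx_scalar scalerA divff ?scale1r // gt_eqF.
  rewrite wE diag_const_mx mul_mx_scalar -scalemxAr mulmxA Hv scalerA -ss.
  by rewrite mulKf // gt_eqF.
rewrite trmxCZ sVJ -scalemxAl -scalemxAr scalerA -invfM ss.
rewrite trmxC_conj -[(_)^T]conj_trmxC -map_mxM AvAv map_scalar_mx /=.
by rewrite scale_scalar_mx geC0_conj ?ltW // mulVf // gt_eqF.
Qed.

(** Orthonormality of the columns of [[V W]]; the relation [V^H W = 0] is the
    adjoint of the last condition. *)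
Definition ortho_frame k (V W : 'M[C]_(m, k)) :=
  [/\ V^t* *m V = 1%:M, W^t* *m W = 1%:M & W^t* *m V = 0].

Lemma ortho_frame_swap k (V W : 'M[C]_(m, k)) :
  ortho_frame V W -> ortho_frame W (- V).
Proof.
case=> VV WW WV; split=> //.
  by rewrite trmxCN mulNmx mulmxN opprK.
by rewrite trmxCN mulNmx trmxC_mul_eq0C ?oppr0.
Qed.

Lemma ortho_frame_row_mx k l (V W : 'M[C]_(m, k)) (v w : 'M[C]_(m, l)) :
  ortho_frame v w -> ortho_frame V W ->
  V^t* *m v = 0 -> W^t* *m v = 0 -> V^t* *m w = 0 -> W^t* *m w = 0 ->
  ortho_frame (row_mx v V) (row_mx w W).
Proof.
case=> vv ww wv [VV WW WV] Vv Wv Vw Ww.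
split; rewrite trmxC_row_mx mul_col_row.
- by rewrite vv VV Vv (trmxC_mul_eq0C Vv) -scalar_mx_block.
- by rewrite ww WW Ww (trmxC_mul_eq0C Ww) -scalar_mx_block.
- by rewrite wv WV Wv (trmxC_mul_eq0C Vw) block_mx0.
Qed.

Lemma paired_row_mx k l (V W : 'M[C]_(m, k)) d (v w : 'M[C]_(m, l)) e :
  paired v w e -> paired V W d ->
  paired (row_mx v V) (row_mx w W) (row_mx e d).
Proof.
case=> e_gt0 Av Aw [d_gt0 AV AW]; split=> [j||].
- by rewrite mxE; case: split.
- rewrite mul_mx_row Av AV map_row_mx diag_mx_row mul_row_block.
  by rewrite !mulmx0 addr0 add0r.
- rewrite map_row_mx mul_mx_row Aw AW diag_mx_row mul_row_block.
  by rewrite !mulmx0 addr0 add0r.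
Qed.

(** The vectors orthogonal to the columns of [V] and [W] are the adjoints of the
    rows killed by [M = [V W]].  As [(A^H A) M = M D] for a diagonal [D], these
    rows are stable under [A^H A], and the rank of [M] is too small for the
    zero row to be the only one. *)
Lemma exists_eigenvector_ortho k (V W : 'M[C]_(m, k)) d :
  paired V W d -> (k + k < m)%N ->
  exists (v : 'cV[C]_m) (b : C),
  [/\ v^t* *m v = 1%:M, A^t* *m A *m v = b *: v,
      V^t* *m v = 0 & W^t* *m v = 0].
Proof.
move=> VW lt_k_m; have [_ AV AW] := VW; have [_ AW' AV'] := paired_swap VW.
pose M := row_mx V W; pose H := A^t* *m A.
have HJ : H^t* = H by rewrite trmxC_mul trmxCK.
have HM : exists D, H *m M = M *m D.
  exists (block_mx (diag_mx d *m diag_mx d) 0 0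
    (diag_mx (map_mx GRing.inv d) *m diag_mx (map_mx GRing.inv d))).
  rewrite mul_mx_row mul_row_block !mulmx0 addr0 add0r -!mulmxA AV AW'.
  by rewrite (mulmxA (A^t*)) AW (mulmxA (A^t*)) AV' !mulmxA.
have [] := @stable_row_eigenvector C _ _ (kermx M) H.
- have [D HMD] := HM.
  by apply/sub_kermxP; rewrite -mulmxA HMD mulmxA mulmx_ker mul0mx.
- rewrite -mxrank_eq0 mxrank_ker -lt0n subn_gt0.
  by apply: leq_ltn_trans (rank_leq_col _) lt_k_m.
move=> x x_neq0 [/sub_kermxP xM [a xH]].
pose v0 := x^t*.
have v0_neq0 : v0 != 0.
  by apply: contra_neq x_neq0 => v00; rewrite -[x]trmxCK -/v0 v00 trmx0 map_mx0.
pose c := (sqrtC ((v0^t* *m v0) 0 0))^-1.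
have c_gt0 : 0 < c by rewrite invr_gt0 sqrtC_gt0 gram_gt0.
have Mv0 : col_mx (V^t*) (W^t*) *m v0 = 0.
  by rewrite -trmxC_row_mx -trmxC_mul xM trmx0 map_mx0.
have [Vv0 Wv0] : V^t* *m v0 = 0 /\ W^t* *m v0 = 0.
  by apply: eq_col_mx; rewrite -mul_col_mx Mv0 col_mx0.
exists (c *: v0), (Num.conj a); split.
- rewrite trmxCZ -scalemxAl -scalemxAr scalerA.
  rewrite [v0^t* *m v0]mx11_scalar scale_scalar_mx geC0_conj ?(ltW c_gt0) //.
  by rewrite -expr2 exprVn sqrtCK mulVf // gt_eqF ?gram_gt0.
- rewrite -scalemxAr scalerA mulrC -scalerA; congr (_ *: _).
  by rewrite -/H -HJ -trmxC_mul xH trmxCZ.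
- by rewrite -scalemxAr Vv0 scaler0.
- by rewrite -scalemxAr Wv0 scaler0.
Qed.

(** The greedy construction: each step adds one pair orthogonal to the previous
    ones, exchanging its members if its singular value is below [1]. *)
Lemma exists_paired_frame k : (k + k <= m)%N ->
  exists (V W : 'M[C]_(m, k)) d,
  [/\ paired V W d, ortho_frame V W & forall j, 1 <= d 0 j].
Proof.
elim: k => [_|k IHk lt_k_m].
  by exists 0, 0, 0; split=> [||[]//]; split; try (by case);
    apply/matrixP => ? [].
have [|V [W [d [VWpair VWframe d_ge1]]]] := IHk.
  by apply: leq_trans lt_k_m; rewrite leq_add.
have [|v [b [v1 Hv Vv Wv]]] := exists_eigenvector_ortho VWpair.
  by apply: leq_trans lt_k_m; rewrite addSn addnS ltnS leqnSn.
have [w [e [vwpair w1]]] := eigenvector_paired v1 Hv.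
have Ww := paired_ortho VWpair vwpair Vv.
have Vw : V^t* *m w = 0.
  have := paired_ortho (paired_swap VWpair) vwpair Wv.
  by rewrite trmxCN mulNmx => /eqP; rewrite oppr_eq0 => /eqP.
have vwframe : ortho_frame v w by split=> //; exact: paired_isotropic vwpair.
have e_gt0 : 0 < e 0 0 by case: vwpair.
have [e_ge1|e_lt1] := real_leP (real1 C) (gtr0_real e_gt0).
  (* the index type 'I_k.+1 has to be read as 'I_(1 + k) here and below *)
  exists (row_mx v V), (row_mx w W), (row_mx e d); split.
  - exact: (@paired_row_mx k 1).
  - exact: (@ortho_frame_row_mx k 1).
  - by move=> j; rewrite (@mxE _ 1 (1 + k)); case: split => // i; rewrite ord1.
exists (row_mx w V), (row_mx (- v) W), (row_mx (map_mx GRing.inv e) d); split.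
- exact: (@paired_row_mx k 1) (paired_swap vwpair) VWpair.
- apply: (@ortho_frame_row_mx k 1) => //; first exact: ortho_frame_swap.
    by rewrite mulmxN Vv oppr0.
  by rewrite mulmxN Wv oppr0.
- move=> j; rewrite (@mxE _ 1 (1 + k)); case: split => // i; rewrite ord1 mxE.
  by rewrite invf_ge1 ?ltW.
Qed.

End Paired.

(** * Uniqueness of the singular values *)

(** The characteristic matrices of [X] and [Y] satisfy the same intertwining
    relation, whose determinants can be compared since [det P] is not zero. *)
Lemma char_poly_intertwine (F : fieldType) m (X Y P : 'M[F]_m) :
  P \in unitmx -> X *m P = P *m Y -> char_poly X = char_poly Y.
Proof.
move=> P_unit XP; pose Q : 'M[{poly F}]_m := map_mx polyC P.
have detQ_neq0 : \det Q != 0.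
  by rewrite det_map_mx polyC_eq0 -unitfE -unitmxE.
apply: (mulIf detQ_neq0); rewrite mulrC [RHS]mulrC /char_poly -!det_mulmx.
rewrite [LHS]det_mulmx mulrC -det_mulmx /char_poly_mx mulmxBl mulmxBr.
by rewrite -!map_mxM XP scalar_mxC.
Qed.

Lemma perm_eq_image_ord_add (T : eqType) m n (f : 'I_(m + n) -> T) :
  perm_eq [seq f i | i : 'I_(m + n)]
    ([seq f (lshift n i) | i : 'I_m] ++ [seq f (rshift m i) | i : 'I_n]).
Proof.
rewrite /image_mem [X in X ++ _](map_comp f) [X in _ ++ X](map_comp f) -map_cat.
apply: perm_map; apply: uniq_perm; first exact: enum_uniq.
  rewrite cat_uniq (map_inj_uniq (@lshift_inj _ _)).
  rewrite (map_inj_uniq (@rshift_inj _ _)).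
  rewrite !enum_uniq andbT /=.
  apply/hasPn => _ /mapP[i _ ->]; apply/mapP => -[j _ /eqP].
  by rewrite eq_rlshift.
move=> i; rewrite mem_enum mem_cat; apply/esym/orP.
by case: (split_ordP i) => j ->; [left|right]; apply: map_f; rewrite mem_enum.
Qed.

(** The indices are sorted, rather than the values, so that the sorted list can
    be read as an injective map. *)
Lemma exists_sorting_perm disp (T : orderType disp) n (f : 'I_n -> T) :
  exists s : 'S_n, forall i j : 'I_n, (i <= j)%N -> (f (s j) <= f (s i))%O.
Proof.
pose leT (i j : 'I_n) := (f j <= f i)%O.
have leT_total : total leT by move=> i j; exact: le_total.
have leT_trans : transitive leT by move=> j i k ij jk; exact: le_trans jk ij.
pose r := sort leT (enum 'I_n).
have size_r : size r = n by rewrite size_sort size_enum_ord.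
(* 'I_n may be empty, so the index itself serves as the default value *)
have r_inj : injective (fun i : 'I_n => nth i r i).
  move=> i j /eqP; rewrite (set_nth_default j) ?size_r //.
  rewrite nth_uniq ?size_r ?sort_uniq ?enum_uniq // => /eqP; exact: val_inj.
exists (perm r_inj) => i j le_ij; rewrite !permE (set_nth_default i) ?size_r //.
have leT_refl : reflexive leT by move=> k; exact: lexx.
have r_sorted : sorted leT r by exact: sort_sorted.
by apply: (sorted_leq_nth leT_trans leT_refl) r_sorted _ _ _ _ _;
  rewrite ?inE ?size_r.
Qed.

Section SingularValues.

Variable R : realType.

(** The decomposition gives [A^H A V = V S^2] with [V] invertible, so [A^H A]
    has the characteristic polynomial of the diagonal matrix [S^2]. *)
Lemma svd_char_poly m (A U S V : 'M[R[i]]_m) : is_svd A U S V ->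
  char_poly (A^t* *m A) = \prod_i ('X - (S i i ^+ 2)%:P).
Proof.
case=> U_unitary V_unitary S_diag S_ge0 AE.
have SE : S = diag_mx (\row_j S j j).
  apply/matrixP => i j; rewrite !mxE; have [->|ij] := eqVneq i j.
    by rewrite mulr1n.
  by rewrite mulr0n; apply: (is_diag_mxP S_diag).
have HV : A^t* *m A *m V = V *m (S *m S).
  have SJ : S^t* = S by rewrite SE trmxC_diag_ge0 // => j; rewrite mxE.
  have UU : U^t* *m U = 1%:M by apply/mulmx1C/unitarymxP.
  have VV : V^t* *m V = 1%:M by apply/mulmx1C/unitarymxP.
  rewrite AE !trmxC_mul trmxCK SJ -!mulmxA VV mulmx1.
  by rewrite (mulmxA (U^t*)) UU mul1mx.
rewrite (char_poly_intertwine (unitarymx_unit V_unitary) HV).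
rewrite SE mulmx_diag char_poly_trig ?diag_mx_is_trig //.
by apply: eq_bigr => i _; rewrite !mxE eqxx mulr1n expr2.
Qed.

(** The roots of the characteristic polynomial of [A^H A] determine the squares
    of the diagonal entries, and nonnegative numbers are the square roots of
    their squares. *)
Lemma svd_diag_unique m (A U S V U' S' V' : 'M[R[i]]_m) :
  is_svd A U S V -> is_svd A U' S' V' ->
  perm_eq [seq S i i | i : 'I_m] [seq S' i i | i : 'I_m].
Proof.
move=> svd svd'; have [_ _ _ S_ge0 _] := svd; have [_ _ _ S'_ge0 _] := svd'.
have sqrtK (T : 'M[R[i]]_m) : (forall i, 0 <= T i i) ->
    [seq T i i | i : 'I_m] = map sqrtC [seq T i i ^+ 2 | i : 'I_m].
  by move=> T_ge0; rewrite -map_comp; apply: eq_map => i /=; rewrite sqrCK.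
rewrite (sqrtK S) // (sqrtK S') //; apply: perm_map; apply: prod_XsubC_eq.
by rewrite !big_image /= -(svd_char_poly svd) (svd_char_poly svd').
Qed.

Lemma paired_singular_triplet m k (A : 'M[R[i]]_m) (V W : 'M[R[i]]_(m, k))
    (d : 'rV[R[i]]_k) j s :
  paired A V W d -> V^t* *m V = 1%:M -> W^t* *m W = 1%:M -> d 0 j = (s%:C)%C ->
  singular_triplet A (cj (col j W)) (col j V) s.
Proof.
case=> d_gt0 AV AW VV WW dj.
have col_unit (X : 'M[R[i]]_(m, k)) : X^t* *m X = 1%:M -> unit_vector (col j X).
  move=> /matrixP/(_ j j) XX; rewrite /unit_vector sum_norm_gram.
  transitivity ((1%:M : 'M[R[i]]_k) j j); last by rewrite mxE eqxx.
  by rewrite -XX !mxE; apply: eq_bigr => i _; rewrite !mxE.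
have col_diag (X : 'M[R[i]]_(m, k)) :
  col j (X *m diag_mx d) = (s%:C)%C *: col j X.
  by apply/colP => i; rewrite mul_mx_diag !mxE dj mulrC.
have mul_col (B : 'M[R[i]]_m) (X : 'M[R[i]]_(m, k)) :
  B *m col j X = col j (B *m X) by rewrite !colE mulmxA.
split; first by rewrite -ler0c -dj ltW.
- have := col_unit _ WW; rewrite /unit_vector => <-.
  by apply: eq_bigr => i _; rewrite mxE norm_conjC.
- exact: col_unit.
- by rewrite mul_col AV col_diag map_col.
- by rewrite map_col mul_col AW col_diag.
Qed.

End SingularValues.

(** * Sorting the pairs and assembling the decomposition *)

Lemma paired_col_perm (C : numClosedFieldType) m k (A : 'M[C]_m)
    (V W : 'M[C]_(m, k)) d (s : 'S_k) :
  paired A V W d -> paired A (col_perm s V) (col_perm s W) (col_perm s d).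
Proof.
have mul_col_perm (B : 'M[C]_m) (X : 'M[C]_(m, k)) :
  B *m col_perm s X = col_perm s (B *m X) by rewrite !col_permE mulmxA.
have col_perm_diag (X : 'M[C]_(m, k)) :
    col_perm s (X *m diag_mx d) = col_perm s X *m diag_mx (col_perm s d).
  by apply/matrixP => i j; rewrite !mul_mx_diag !mxE.
case=> d_gt0 AV AW; split=> [j||]; first by rewrite mxE.
  by rewrite mul_col_perm AV col_perm_diag map_col_perm.
by rewrite map_col_perm mul_col_perm AW col_perm_diag.
Qed.

Lemma ortho_frame_col_perm (C : numClosedFieldType) m k (V W : 'M[C]_(m, k))
    (s : 'S_k) :
  ortho_frame V W -> ortho_frame (col_perm s V) (col_perm s W).
Proof.
have gram_col_perm (X Y : 'M[C]_(m, k)) :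
    (col_perm s X)^t* *m col_perm s Y = \matrix_(i, j) (X^t* *m Y) (s i) (s j).
  by apply/matrixP => i j; rewrite !mxE; apply: eq_bigr => l _; rewrite !mxE.
case=> VV WW WV; split; rewrite gram_col_perm ?VV ?WW ?WV.
- by apply/matrixP => i j; rewrite !mxE (inj_eq perm_inj).
- by apply/matrixP => i j; rewrite !mxE (inj_eq perm_inj).
- by apply/matrixP => i j; rewrite !mxE.
Qed.

(** [V] and [W] have [n + n] columns in total, as many as the dimension, so a
    left inverse of [[V W]] is also a right inverse. *)
Lemma ortho_frame_unitary (C : numClosedFieldType) n
    (V W : 'M[C]_(n + n, n)) :
  ortho_frame V W -> row_mx V W \is unitarymx.
Proof.
case=> VV WW WV; rewrite -trmxC_unitary; apply/unitarymxP.
rewrite trmxCK trmxC_row_mx mul_col_row VV WW WV (trmxC_mul_eq0C WV).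
by rewrite -scalar_mx_block.
Qed.

(** [U] is the conjugate of [[W, - V]], the frame of the swapped pairs, and
    [A V = U Sigma] combines the equations of the pairs and of the swapped
    pairs. *)
Lemma paired_svd (R : realType) n (A : 'M[R[i]]_(n + n))
    (V W : 'M[R[i]]_(n + n, n)) d :
  A *m cj A = - 1%:M -> paired A V W d -> ortho_frame V W ->
  is_svd A (row_mx (cj W) (- cj V))
    (block_mx (diag_mx d) 0 0 (diag_mx (map_mx GRing.inv d))) (row_mx V W).
Proof.
move=> skewA VW frame; have [d_gt0 AV _] := VW.
have [_ AW _] := paired_swap skewA VW.
have V_unitary := ortho_frame_unitary frame.
split=> //.
- rewrite -conj_mxN -map_row_mx conjC_unitary.
  exact/ortho_frame_unitary/ortho_frame_swap.
- by rewrite -diag_mx_row diag_mx_is_diag.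
- move=> i; rewrite -diag_mx_row mxE eqxx mulr1n mxE.
  by case: split => j; rewrite ?mxE ?invr_ge0 ltW.
- rewrite -[LHS](mulmxtVK _ V_unitary) mul_mx_row AV AW mul_row_block.
  by rewrite !mulmx0 addr0 add0r conj_mxN.
Qed.

Lemma exists_sorted_paired_frame (R : realType) n (A : 'M[R[i]]_(n + n)) :
  A *m cj A = - 1%:M ->
  exists (sigma : 'I_n -> R) (V W : 'M[R[i]]_(n + n, n)),
  [/\ paired A V W (\row_j (sigma j)%:C%C), ortho_frame V W,
      forall i j : 'I_n, (i <= j)%N -> sigma j <= sigma i
    & forall j, 1 <= sigma j].
Proof.
move=> skewA.
have [V [W [d [VW frame d_ge1]]]] := exists_paired_frame skewA (leqnn (n + n)).
have dE j : (complex.Re (d 0 j))%:C%C = d 0 j.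
  by apply/RRe_real/ger0_real/(le_trans ler01)/d_ge1.
have [s s_sorted] := exists_sorting_perm (fun j => complex.Re (d 0 j)).
exists (fun j => complex.Re (d 0 (s j))), (col_perm s V), (col_perm s W).
split=> //; last by move=> j; rewrite -lecR dE.
  rewrite (_ : \row_j _ = col_perm s d); first exact: paired_col_perm.
  by apply/rowP => j; rewrite !mxE dE.
exact: ortho_frame_col_perm.
Qed.

Local Open Scope complex_scope.

Theorem theorem10 (R : realType) (n : nat) (A : 'M[R[i]]_(n + n))
    (hA : skew_coninvolutory A) :
  exists (sigma : 'I_n -> R) (u v : 'I_n -> 'cV[R[i]]_(n + n)),
    let S : 'M[R[i]]_n := diag_mx (\row_j (sigma j)%:C) in
    let Sigma : 'M[R[i]]_(n + n) := block_mx S 0 0 (invmx S) in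
    let U : 'M[R[i]]_(n + n) :=
      row_mx (mx_of_cols u) (mx_of_cols (fun j => - conj_mx (v j))) in
    let V : 'M[R[i]]_(n + n) :=
      row_mx (mx_of_cols v) (mx_of_cols (fun j => conj_mx (u j))) in
    (forall i j : 'I_n, (i <= j)%N -> sigma j <= sigma i) /\
    (forall j : 'I_n, 1 <= sigma j) /\
    singular_values A
      ([seq sigma j | j : 'I_n] ++ [seq (sigma j)^-1 | j : 'I_n]) /\
    (forall j : 'I_n,
       singular_triplet A (u j) (v j) (sigma j) /\
       singular_triplet A (- conj_mx (v j)) (conj_mx (u j)) (sigma j)^-1) /\
    is_svd A U Sigma V.
Proof.
have [sigma [V [W [VW frame sigma_sorted sigma_ge1]]]] :=
  exists_sorted_paired_frame hA.
exists sigma, (fun j => cj (col j W)), (fun j => col j V) => S Sigma U V'.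
have [sigma_gt0 _ _] := VW.
pose d := \row_j (sigma j)%:C; pose dV := map_mx GRing.inv d.
have SVE : invmx S = diag_mx dV.
  have SSV : S *m diag_mx dV = 1%:M by apply: diag_mxV.
  have [S_unit _] := mulmx1_unit SSV.
  by rewrite -[RHS](mulKmx S_unit) SSV mulmx1.
have UE : U = row_mx (cj W) (- cj V).
  by congr row_mx; apply/matrixP => i j; rewrite !mxE.
have VE : V' = row_mx V W.
  by congr row_mx; apply/matrixP => i j; rewrite !mxE ?conjCK.
have svd : is_svd A U Sigma V'.
  by rewrite UE VE /Sigma SVE; apply: paired_svd.
have [VV WW _] := frame.
have [_ NVNV _] := ortho_frame_swap frame.
split; first exact: sigma_sorted.
split; first exact: sigma_ge1.
split.
  split; first by exists U, Sigma, V'.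
  move=> U1 S1 V1 /svd_diag_unique/(_ svd)/perm_trans; apply.
  apply: (perm_trans (perm_eq_image_ord_add _)).
  have diag_l j : Sigma (lshift n j) (lshift n j) = (sigma j)%:C.
    by rewrite block_mxEul !mxE eqxx mulr1n.
  have diag_r j : Sigma (rshift n j) (rshift n j) = ((sigma j)^-1)%:C.
    by rewrite block_mxEdr SVE !mxE eqxx mulr1n fmorphV.
  by rewrite /image_mem (eq_map diag_l) (eq_map diag_r) map_cat -!map_comp.
split; last exact: svd.
move=> j; split.
  by apply: paired_singular_triplet VW VV WW _; rewrite mxE.
have djV : dV 0 j = ((sigma j)^-1)%:C by rewrite !mxE fmorphV.
have := paired_singular_triplet (paired_swap hA VW) WW NVNV djV.
have -> : cj (col j (- V)) = - conj_mx (col j V).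
  by apply/matrixP => k l; rewrite !mxE rmorphN.
by rewrite /conj_mx map_conjK.
Qed.
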